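(* Assume $\mathfrak p=\mathfrak c$. Then there exist nonseparable $G$-spaces that are not isomorphic to any $\mathcal C$-space.
   Context: A $G$-space is a closed subspace $E$ of a space $C(S)$, $S$ compact Hausdorff, for which there is a set of triples $A=\{(s_\alpha^1,s_\alpha^2,\lambda_\alpha)\}_\alpha\subseteq S\times S\times\mathbb R$ such that $E=\{f\in C(S): f(s_\alpha^1)=\lambda_\alpha f(s_\alpha^2)\text{ for all }\alpha\}$. A Banach space is a $\mathcal C$-space if it is (linearly) isomorphic to $C(T)$ for some compact Hausdorff space $T$. $\mathfrak c$ is the cardinality of the continuum, and $\mathfrak p$ is the pseudointersection number: the least cardinality of a family $\mathcal F$ of subsets of $\mathbb N$ such that every finite subfamily of $\mathcal F$ has infinite intersection but there is no infinite $A\subseteq \mathbb N$ with $A\setminus F$ finite for all $F\in\mathcal F$. *)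

(* Defs.v *)
From HB Require Import structures.
From mathcomp Require Import all_boot all_order all_algebra.
From mathcomp Require Import ring lra.
From mathcomp Require Import all_classical all_reals topology normedtype.
Set Implicit Arguments.
Unset Strict Implicit.
Unset Printing Implicit Defensive.
Import Order.TTheory GRing.Theory Num.Theory.
Import numFieldNormedType.Exports.
Local Open Scope classical_set_scope.
Local Open Scope ring_scope.
Local Open Scope card_scope.

(* Not required to be inhabited: the empty space is allowed, with C(S) = 0. *)
HB.mixin Record Topological_isCompactHausdorff T & Topological T := {
  compactT : compact [set: T];
  hausdorffT : hausdorff_space T
}.

#[short(type="compactHausdorffType")]
HB.structure Definition CompactHausdorff :=
  {T of Topological T & Topological_isCompactHausdorff T}.

Section ContinuousFunctions.
Variables (S : compactHausdorffType) (R : realType).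

Definition continuous_pred : {pred S -> R} :=
  mem [set f : S -> R | continuous f].

(* The real Banach space C(S), with the supremum norm. *)
Record cspace := CSpace {
  cspace_fun :> S -> R;
  cspace_subproof : cspace_fun \in continuous_pred
}.

HB.instance Definition _ := [isSub for cspace_fun].
HB.instance Definition _ := [Choice of cspace by <:].

Lemma cspace_continuous (f : cspace) : continuous f.
Proof. by have := cspace_subproof f; rewrite inE. Qed.

Lemma continuous_submod_closed : submod_closed continuous_pred.
Proof.
split=> [|a f g]; rewrite !inE => /=; first by move=> x; exact: cst_continuous.
move=> cf cg x; apply: cvgD; last exact: cg.
by apply: cvgM; [exact: cvg_cst|exact: cf].
Qed.

HB.instance Definition _ := GRing.isSubmodClosed.Build R (S -> R)
  continuous_pred continuous_submod_closed.
HB.instance Definition _ := [SubChoice_isSubLmodule of cspace by <:].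

Definition sup_norm (f : cspace) : R := sup (range (fun s => `|f s|)).

Lemma has_ubound_norm (f : cspace) : has_ubound (range (fun s => `|f s|)).
Proof.
have cK : compact (range (fun s => `|f s|)).
  apply: continuous_compact; last exact: compactT.
  apply: continuous_subspaceT => x.
  by apply: (@continuous_comp _ _ _ f Num.norm);
    [exact: cspace_continuous|exact: norm_continuous].
have [M [_ /(_ (M + 1))]] := compact_bounded cK.
rewrite ltrDl ltr01 => /(_ erefl) H; exists (M + 1) => y fy.
by rewrite (le_trans (ler_norm y)) //; exact: H.
Qed.

Lemma sup_norm_ge (f : cspace) s : `|f s| <= sup_norm f.
Proof. by apply: ub_le_sup; [exact: has_ubound_norm|exists s]. Qed.

Lemma sup_norm_le (f : cspace) (r : R) : 0 <= r ->
  (forall s, `|f s| <= r) -> sup_norm f <= r.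
Proof.
move=> r0 fr; have [[y ry]|/nonemptyPn e] := pselect (range (fun s => `|f s|) !=set0).
  by apply: ge_sup; [exists y|move=> _ [s _ <-]].
by rewrite /sup_norm e sup0.
Qed.

Lemma sup_norm_ge0 (f : cspace) : 0 <= sup_norm f.
Proof.
have [[_ [s _ _]]|/nonemptyPn e] := pselect (range (fun s => `|f s|) !=set0).
  exact: le_trans (sup_norm_ge f s).
by rewrite /sup_norm e sup0.
Qed.

Lemma cspaceP (f g : cspace) : f =1 g -> f = g.
Proof. by move=> fg; apply: val_inj; exact/funext. Qed.

Lemma sup_normD (f g : cspace) : sup_norm (f + g) <= sup_norm f + sup_norm g.
Proof.
apply: sup_norm_le => [|s]; first by rewrite addr_ge0 ?sup_norm_ge0.
by rewrite (le_trans (ler_normD _ _))// lerD ?sup_norm_ge.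
Qed.

Lemma sup_normZ (a : R) (f : cspace) : sup_norm (a *: f) = `|a| * sup_norm f.
Proof.
have le b g : sup_norm (b *: g) <= `|b| * sup_norm g.
  apply: sup_norm_le => [|s]; first by rewrite mulr_ge0 ?sup_norm_ge0.
  by rewrite [X in `|X|](_ : _ = b * g s)// normrM ler_wpM2l ?sup_norm_ge.
apply/eqP; rewrite eq_le le /=; have [->|a0] := eqVneq a 0.
  by rewrite normr0 mul0r sup_norm_ge0.
rewrite -ler_pdivlMl ?normr_gt0// -normfV.
by have := le a^-1 (a *: f); rewrite scalerA mulVf// scale1r.
Qed.

Lemma sup_norm_eq0 (f : cspace) : sup_norm f = 0 -> f = 0.
Proof.
move=> f0; apply: cspaceP => s; apply/eqP.
by rewrite -normr_le0 -f0 sup_norm_ge.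
Qed.

HB.instance Definition _ :=
  Lmodule_isNormed.Build R cspace sup_normD sup_normZ sup_norm_eq0.

Lemma cspace_normE (f : cspace) : `|f| = sup_norm f.
Proof. by []. Qed.

Lemma cspace_distE (f g : cspace) s : `|f s - g s| <= `|f - g|.
Proof. exact: (sup_norm_ge (f - g) s). Qed.

Lemma cspace_complete (F : set_system cspace) :
  ProperFilter F -> cauchy F -> cvg F.
Proof.
move=> FF Fc.
have Fs s : cauchy ((fun f : cspace => f s) @ F).
  apply/cauchy_exP => e e0; have /cauchyP/(_ e e0)[f0 Ff0] := Fc.
  exists (f0 s); apply: (@filterS _ F _ (ball f0 e)) Ff0 => g /=; rewrite -!ball_normE /=.
  by apply: le_lt_trans; exact: cspace_distE.
pose l s : R := lim ((fun f : cspace => f s) @ F).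
have Fl s : (fun f : cspace => f s) @ F --> l s by exact: cauchy_cvg.
have Fld s d : 0 < d -> \forall f \near F, `|l s - (f : cspace) s| < d.
  by have /cvgrPdist_lt := Fl s; exact.
have Fu e : 0 < e -> exists2 f0 : cspace, F (ball f0 e) &
    forall s, `|l s - f0 s| <= e.
  move=> e0; have /cauchyP/(_ e e0)[f0 Ff0] := Fc; exists f0 => // s.
  apply/ler_addgt0Pr => d d0; near F => g.
  rewrite (le_trans (ler_distD (g s) _ _))// addrC lerD//.
    have : ball f0 e g by near: g.
    rewrite -ball_normE /= => /ltW; apply: le_trans.
    by rewrite distrC; exact: cspace_distE.
  by apply: ltW; near: g; exact: Fld.
have cl : continuous l.
  move=> x; apply/cvgrPdist_le => e e0; have e30 : 0 < e / 3 by rewrite divr_gt0.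
  have [f0 _ lf0] := Fu _ e30.
  have /cvgrPdist_lt/(_ _ e30) := @cspace_continuous f0 x.
  apply: filterS => y /ltW xy.
  rewrite (le_trans (ler_distD (f0 x) _ _))// (_ : e = e / 3 + (e / 3 + e / 3)).
    rewrite lerD// (le_trans (ler_distD (f0 y) _ _))// lerD//.
    by rewrite distrC.
  by field.
have lP : l \in continuous_pred by rewrite inE.
apply/cvg_ex; exists (CSpace lP); apply/cvgrPdist_le => e e0.
have [f0 Ff0 lf0] := Fu _ (divr_gt0 e0 (ltr0Sn R 1)).
apply: filterS Ff0 => g; rewrite -ball_normE /= => /ltW f0g.
apply: sup_norm_le => [|s]; first exact: ltW.
rewrite (le_trans (ler_distD (f0 s) _ _))// [leRHS]splitr lerD//.
by apply: le_trans f0g; exact: cspace_distE.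
Unshelve. all: by end_near. Qed.

HB.instance Definition _ := Uniform_isComplete.Build cspace cspace_complete.

End ContinuousFunctions.

Section Subspaces.
Variables (R : realType) (V W : normedModType R).

Definition closed_subspace (E : set V) :=
  submod_closed [in E] /\ closed E.

Definition separable (E : set V) :=
  exists D : set V, [/\ D `<=` E, countable D & E `<=` closure D].

(* A linear homeomorphism phi : E -> F, with inverse psi. *)
Definition isomorphic (E : set V) (F : set W) :=
  exists (phi : V -> W) (psi : W -> V),
    [/\ set_fun E F phi, set_fun F E psi,
        {in E, cancel phi psi} & {in F, cancel psi phi}] /\
    [/\ (forall (a : R) (u v : V), E u -> E v ->
          phi (a *: u + v) = a *: phi u + phi v),
        {within E, continuous phi} & {within F, continuous psi}].

End Subspaces.

Definition is_G_space (R : realType) (S : compactHausdorffType)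
    (E : set (cspace S R)) :=
  closed_subspace E /\
  exists A : set (S * S * R),
    E = [set f | forall s1 s2 lambda, A (s1, s2, lambda) ->
                   f s1 = lambda * f s2].

Definition is_C_space (R : realType) (X : completeNormedModType R) :=
  exists T : compactHausdorffType, isomorphic [set: X] [set: cspace T R].

Definition strong_fip (F : set (set nat)) :=
  forall G : set (set nat), finite_set G -> G `<=` F ->
    infinite_set (\bigcap_(A in G) A).

Definition has_pseudointersection (F : set (set nat)) :=
  exists A : set nat, infinite_set A /\ forall B, F B -> finite_set (A `\` B).

(* The cardinal number of K is the least cardinality of a family with the
   strong finite intersection property and no pseudointersection. *)
Definition is_pseudointersection_number (U : Type) (K : set U) :=
  (exists F, [/\ strong_fip F, ~ has_pseudointersection F & F #= K]) /\
  (forall F, strong_fip F -> ~ has_pseudointersection F -> K #<= F).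

(* Main.v *)
Require Import Defs.
From HB Require Import structures.
From mathcomp Require Import all_boot all_order all_algebra.
From mathcomp Require Import ring lra.
From mathcomp Require Import all_classical all_reals topology normedtype.
Import Order.TTheory GRing.Theory Num.Theory.
Import numFieldNormedType.Exports.
Set Implicit Arguments.
Unset Strict Implicit.
Unset Printing Implicit Defensive.
Local Open Scope classical_set_scope.
Local Open Scope ring_scope.

(** The space is a variant of Benyamini's M-space. Let [X_n] be the bounded
    real sequences with the norm [max (sup |x_i| / (n+1)) (limsup |x_i|)]. It is
    the space of functions on the disjoint union of the Stone-Cech
    compactification of the integers and of its remainder which satisfy
    [f s = f s' / (n+1)] whenever [s] is a free ultrafilter and [s'] its copy in
    the remainder. The G-space below lives on a compactification of the union of
    these compact spaces, and imposes these relations for all [n] at once; each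
    [X_n] is one of its subspaces. The indicator sequences in [X_0] are at mutual
    distance 1, so it is not separable.

    Why it is not a C-space. Let [phi] be an isomorphism onto [C(T)], with
    inverse [psi] and constants [C], and fix [n] much larger than [C]. The
    coordinates of [X_n] become functionals [mu i] on [C(T)]. Their norms may be
    as large as [C (n+1)], but [limsup |mu i g| <= C |g|] for each single [g].
    The lattice structure of [C(T)] allows one to exploit this
    ([asymptotic_decomposition]): along some infinite set [B] of indices,
    [mu i = q i + w i], where [w i] is almost weak-* null and the norm of [q i]
    is bounded independently of [n]. The functional [q i] has the density [h]
    with respect to the total variation [lam i] of [mu i], where [h] nearly
    maximises the upper limit of [2 mu i h - lam i (h^2)]. If [lam i] is seen as
    a measure and [s] is the sign of [mu i], this quantity is
    [lam i (1) - lam i ((s - h)^2)], so [h] is asymptotically the best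
    continuous approximation of [s], and the optimality of [h] is the
    orthogonality relation saying that [w i] tends to zero.

    Up to the small error coming from [w], the sequence [x] can thus be read off
    along [B] from the functionals [q i] composed with [phi], whose norms are
    bounded by some [D] independent of [n]; on sequences vanishing at infinity
    they are small, of order [D / (n+1)]. This would split the null sequences off
    the bounded ones, which the classical argument of Whitley excludes: take
    uncountably many almost disjoint subsets of [B]. The indicator of each of
    them is seen with value at least 3/4 by some [q i], whereas a sum of [m] such
    indicators has norm 1 up to an error at most [m / (n+1)], so a given [q i]
    sees at most [2 D] of them. *)

(** * Linear functionals and pointwise operations on C(T) *)

Section ScalarFunctionals.
Variables (R : realType) (V : lmodType R) (mu : V -> R).
Hypothesis mu_lin : forall a u v, mu (a *: u + v) = a * mu u + mu v.

Lemma functionalD u v : mu (u + v) = mu u + mu v.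
Proof. by rewrite -[u in LHS]scale1r mu_lin mul1r. Qed.

Lemma functional0 : mu 0 = 0.
Proof. by apply: (@addrI _ (mu 0)); rewrite -functionalD !addr0. Qed.

Lemma functionalZ a u : mu (a *: u) = a * mu u.
Proof. by rewrite -[a *: u]addr0 mu_lin functional0 addr0. Qed.

Lemma functionalN u : mu (- u) = - mu u.
Proof. by rewrite -scaleN1r functionalZ mulN1r. Qed.

Lemma functional_sum (I : Type) (s : seq I) (f : I -> V) :
  mu (\sum_(i <- s) f i) = \sum_(i <- s) mu (f i).
Proof. by apply: (big_morph mu functionalD functional0). Qed.

End ScalarFunctionals.

Section PointwiseOperations.
Variables (R : realType) (T : compactHausdorffType).
Implicit Types f g h : cspace T R.

Lemma mem_continuous_pred (f : T -> R) :
  continuous f -> f \in @continuous_pred T R.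
Proof. by rewrite inE. Qed.

Definition cspace_of (f : T -> R) (cf : continuous f) : cspace T R :=
  CSpace (mem_continuous_pred cf).

Lemma cspaceDE f g t : (f + g) t = f t + g t.
Proof. by []. Qed.

Lemma cspaceNE f t : (- f) t = - f t.
Proof. by []. Qed.

Lemma cspaceZE a f t : (a *: f) t = a * f t.
Proof. by []. Qed.

Lemma cspace0E t : (0 : cspace T R) t = 0.
Proof. by []. Qed.

Lemma cspace_norm_le f (r : R) : 0 <= r -> (forall t, `|f t| <= r) -> `|f| <= r.
Proof. exact: sup_norm_le. Qed.

Lemma cspace_norm_ge f t : `|f t| <= `|f|.
Proof. exact: sup_norm_ge. Qed.

Definition ccst (r : R) : cspace T R := cspace_of (fun t => @cst_continuous T R r t).

Lemma cmul_continuous f g : continuous (fun t => f t * g t).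
Proof. by move=> t; apply: cvgM; exact: cspace_continuous. Qed.

Definition cmul f g : cspace T R := cspace_of (@cmul_continuous f g).

Lemma cclip_continuous f g : continuous (fun t => Num.max (- f t) (Num.min (f t) (g t))).
Proof.
apply: max_fun_continuous; last by apply: min_fun_continuous; exact: cspace_continuous.
exact: (@cspace_continuous _ _ (- f)).
Qed.

Definition cclip f g : cspace T R := cspace_of (@cclip_continuous f g).

(** For small [k] this is a continuous substitute for the sign of [f]. *)
Lemma csign_continuous (k : R) f : 0 < k -> continuous (fun t => f t / (`|f t| + k)).
Proof.
move=> k0 t; apply: cvgM; first exact: cspace_continuous.
apply: cvgV; first by rewrite gt_eqF// ltr_wpDl.
by apply: cvgD; [apply: cvg_norm; exact: cspace_continuous|exact: cvg_cst].
Qed.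

Lemma cmulE f g t : cmul f g t = f t * g t.
Proof. by []. Qed.

Lemma ccstE r t : ccst r t = r.
Proof. by []. Qed.

Definition cspaceE := (cspaceDE, cspaceNE, cspaceZE, cspace0E, cmulE, ccstE).

End PointwiseOperations.

(** * The total variation of a functional on C(T) *)

Section TotalVariation.
Variables (R : realType) (T : compactHausdorffType).
Implicit Types f g h : cspace T R.
Variables (mu : cspace T R -> R) (L : R).
Hypothesis mu_lin : forall a u v, mu (a *: u + v) = a * mu u + mu v.
Hypothesis mu_bound : forall g, `|mu g| <= L * `|g|.
Hypothesis L0 : 0 <= L.

Let dominated f := [set g : cspace T R | forall t, `|g t| <= f t].
Let nonneg f := forall t, 0 <= f t.
Let var f := sup (mu @` dominated f).

Let var_has_sup f : nonneg f -> has_sup (mu @` dominated f).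
Proof.
move=> f0; split; first by exists (mu 0), 0 => // t; rewrite cspaceE normr0.
exists (L * `|f|) => _ [g gf <-]; apply: (le_trans (ler_norm _)).
apply: (le_trans (mu_bound _)); apply: ler_wpM2l => //.
apply: cspace_norm_le => // t; apply: le_trans (cspace_norm_ge f t).
by rewrite (le_trans (gf t))// ler_norm.
Qed.

Let var_ge f g : (forall t, `|g t| <= f t) -> mu g <= var f.
Proof.
move=> gf; apply: ub_le_sup; last by exists g.
by have [] : has_sup (mu @` dominated f) by apply: var_has_sup => t; apply: le_trans (gf t).
Qed.

Let var_le f (c : R) : nonneg f -> 0 <= c -> (forall t, f t <= c) -> var f <= L * c.
Proof.
move=> f0 c0 fc; apply: ge_sup; first by have [] := var_has_sup f0.
move=> _ [g gf <-]; apply: (le_trans (ler_norm _)); apply: (le_trans (mu_bound _)).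
apply: ler_wpM2l => //; apply: cspace_norm_le => // t.
exact: le_trans (fc t).
Qed.

(* Riesz decomposition: a function dominated by [f1 + f2] is the sum of its
   truncation to the interval given by [f1] and of a remainder dominated by [f2]. *)
Let varD f1 f2 : nonneg f1 -> nonneg f2 -> var (f1 + f2) = var f1 + var f2.
Proof.
move=> f10 f20; rewrite /var -sup_sumE; [|exact: var_has_sup..].
congr sup; apply/seteqP; split=> [_ [g gf <-]|_ [_ [g1 g1f <-] [_ [g2 g2f <-] <-]]].
- exists (mu (cclip f1 g)).
    exists (cclip f1 g) => // t /=; rewrite ler_norml.
    by have f1t := f10 t; rewrite le_max lexx ge_max ge_min lexx; lra.
  exists (mu (g - cclip f1 g)); last by rewrite -(functionalD mu_lin) addrC subrK.
  exists (g - cclip f1 g) => // t; rewrite !cspaceE/=.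
  have f1t := f10 t; have f2t := f20 t; have := gf t.
  rewrite cspaceE !ler_norml => /andP[g1 g2].
  case: (leP (f1 t) (g t)) => ?; first by rewrite max_r; lra.
  by case: (leP (- f1 t) (g t)) => ?; lra.
- exists (g1 + g2); last by rewrite (functionalD mu_lin).
  by move=> t; rewrite !cspaceE (le_trans (ler_normD _ _))// lerD.
Qed.

Let var0 : var 0 = 0.
Proof.
have n0 : nonneg 0 by move=> t; rewrite cspaceE.
by apply: (@addrI _ (var 0)); rewrite -varD// !addr0.
Qed.

Let varZ a f : 0 <= a -> nonneg f -> var (a *: f) = a * var f.
Proof.
move=> a0 f0; have [->|an0] := eqVneq a 0.
  by rewrite mul0r scale0r var0.
have le b h : 0 < b -> nonneg h -> b * var h <= var (b *: h).
  move=> b0 h0; rewrite -ler_pdivlMl//; apply: ge_sup; first by have [] := var_has_sup h0.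
  move=> _ [g gh <-]; rewrite ler_pdivlMl// -(functionalZ mu_lin); apply: var_ge => t.
  by rewrite !cspaceE normrM gtr0_norm// ler_wpM2l ?(ltW b0)//; exact: gh.
have a_gt0 : 0 < a by rewrite lt0r an0.
apply/eqP; rewrite eq_le le// andbT -ler_pdivrMl//.
rewrite [leRHS](_ : _ = var (a^-1 *: (a *: f))); last by rewrite scalerA mulVf// scale1r.
by rewrite le ?invr_gt0// => t; rewrite cspaceE mulr_ge0.
Qed.

(** The variation is additive on nonnegative functions, and hence extends to
    differences of such. The three clauses say that [lam] is linear, dominates
    [mu] (so that it is positive, by taking [g = 0]), and has norm at most [L]. *)
Lemma exists_total_variation : exists lam : cspace T R -> R,
  [/\ forall a u v, lam (a *: u + v) = a * lam u + lam v,
      forall f g, (forall t, `|g t| <= f t) -> mu g <= lam f &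
      forall f (c : R), 0 <= c -> (forall t, f t <= c) -> lam f <= L * c].
Proof.
pose up f := f + ccst T `|f|.
have cst_ge0 f : nonneg (ccst T `|f|) by move=> t /=.
have up_ge0 f : nonneg (up f).
  move=> t; rewrite cspaceE /=; have := cspace_norm_ge f t; rewrite ler_norml; lra.
(* Each [f] is the difference of [f + |f|] and of the constant [|f|], both of
   which are nonnegative; by [lamE] the choice of the difference is irrelevant. *)
pose lam f := var (up f) - var (ccst T `|f|).
have lamE f a b : nonneg a -> nonneg b -> f = a - b -> lam f = var a - var b.
  move=> a0 b0 fab; apply/eqP; rewrite subr_eq addrAC eq_sym subr_eq eq_sym.
  rewrite -!varD// /up fab; apply/eqP; congr (var _); apply: cspaceP => t.
  rewrite !cspaceE; ring.
have lamD u v : lam (u + v) = lam u + lam v.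
  rewrite (lamE _ (up u + up v) (ccst T `|u| + ccst T `|v|)).
  - by rewrite (varD (up_ge0 u) (up_ge0 v)) (varD (cst_ge0 u) (cst_ge0 v)) /lam; ring.
  - by move=> t; rewrite cspaceE addr_ge0// up_ge0.
  - by move=> t; rewrite cspaceE addr_ge0// cst_ge0.
  - by apply: cspaceP => t; rewrite !cspaceE; ring.
have lamZp a u : 0 <= a -> lam (a *: u) = a * lam u.
  move=> a0; rewrite (lamE _ (a *: up u) (a *: ccst T `|u|)).
  - by rewrite !varZ// /lam; ring.
  - by move=> t; rewrite cspaceE mulr_ge0// up_ge0.
  - by move=> t; rewrite cspaceE mulr_ge0// cst_ge0.
  - by apply: cspaceP => t; rewrite !cspaceE; ring.
have lamN u : lam (- u) = - lam u.
  rewrite (lamE _ (ccst T `|u|) (up u)); [by rewrite /lam; ring|exact: cst_ge0|exact: up_ge0|].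
  by apply: cspaceP => t; rewrite !cspaceE; ring.
exists lam; split=> [a u v|f g gf|f c c0 fc].
- rewrite lamD; congr (_ + _); have [a0|/ltW a0] := leP 0 a; first exact: lamZp.
  by rewrite -[a in LHS]opprK scaleNr lamN lamZp ?oppr_ge0//; ring.
- have f0 : nonneg f by move=> t; exact: le_trans (gf t).
  by rewrite (lamE f f 0) ?subr0 ?var0 ?subr0//; exact: var_ge.
- rewrite (lamE f (ccst T c) (ccst T c - f)).
  + rewrite lerBlDr; apply: (@le_trans _ _ (L * c)); first by apply: var_le => // t /=.
    rewrite lerDl -(functional0 mu_lin) var_ge// => t; rewrite !cspaceE normr0.
    by have := fc t; lra.
  + by move=> t /=.
  + by move=> t; rewrite !cspaceE/=; have := fc t; lra.
  + by apply: cspaceP => t; rewrite !cspaceE; ring.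
Qed.

End TotalVariation.

(** * Splitting off a weak-* null part from a sequence of functionals *)

Section AsymptoticDecomposition.
Variables (R : realType) (T : compactHausdorffType).
Implicit Types f g h : cspace T R.
Variables (mu : nat -> cspace T R -> R) (L C eta : R).
Hypothesis mu_lin : forall i a u v, mu i (a *: u + v) = a * mu i u + mu i v.
Hypothesis mu_bound : forall i g, `|mu i g| <= L * `|g|.
Hypothesis mu_asymptotic : forall g, `|g| <= 1 -> finite_set [set i | C < mu i g].
Hypotheses (L0 : 0 < L) (eta0 : 0 < eta).

(** The point is that the bound on [q] depends on the asymptotic bound [C], and
    not on the bound [L] for the norms. Let [h] nearly maximise the upper limit
    of [2 mu i h - lam i (h^2)] and let [q i g = lam i (h g)]. Perturbing [h] by
    a small multiple of [g] shows that [mu i g - q i g] is eventually small.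
    Applied to a continuous sign [g0] of [h], this bounds [lam i |h|], the norm of
    [q i], by [mu i g0] up to a small error, hence by [C]. *)
Lemma asymptotic_decomposition :
  exists (B : set nat) (q : nat -> cspace T R -> R),
  [/\ infinite_set B,
      forall i a u v, q i (a *: u + v) = a * q i u + q i v,
      forall i g, B i -> `|q i g| <= (C + 2 * eta) * `|g| &
      forall g, `|g| <= 1 -> finite_set [set i | B i /\ eta < mu i g - q i g]].
Proof.
have /choice[lam lamP] i : exists l : cspace T R -> R,
    [/\ forall a u v, l (a *: u + v) = a * l u + l v,
        forall f g, (forall t, `|g t| <= f t) -> mu i g <= l f &
        forall f (c : R), 0 <= c -> (forall t, f t <= c) -> l f <= L * c].
  exact: exists_total_variation (mu_lin i) (mu_bound i) (ltW L0).
have lam_lin i := let: And3 l _ _ := lamP i in l.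
have lam_ge i := let: And3 _ l _ := lamP i in l.
have lam_le i := let: And3 _ _ l := lamP i in l.
have lam_ge0 i f : (forall t, 0 <= f t) -> 0 <= lam i f.
  move=> f0; rewrite -(functional0 (mu_lin i)); apply: lam_ge => t.
  by rewrite cspaceE normr0.
have lam_mono i f g : (forall t, f t <= g t) -> lam i f <= lam i g.
  move=> fg; rewrite -subr_ge0 -(functionalN (lam_lin i)) -(functionalD (lam_lin i)).
  by apply: lam_ge0 => t; rewrite !cspaceE subr_ge0.
pose Phi i h := 2 * mu i h - lam i (cmul h h).
(* By positivity of [lam i], since [2 |h| <= 1 + h^2]. *)
have Phi_le i h : Phi i h <= L.
  have mule : mu i (2 *: h) <= lam i (ccst T 1 + cmul h h).
    apply: lam_ge => t; rewrite !cspaceE ler_norml.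
    have := sqr_ge0 (h t + 1); have := sqr_ge0 (h t - 1); rewrite !expr2; nra.
  rewrite (functionalZ (mu_lin i)) (functionalD (lam_lin i)) in mule.
  have := lam_le i (ccst T 1) 1 ler01 (fun=> lexx _); rewrite /Phi; lra.
pose levels := [set s | exists h, infinite_set [set i | s < Phi i h]].
have levels_sup : has_sup levels.
  split.
    exists (-1), 0; rewrite (_ : [set _ | _] = setT); first exact: infinite_nat.
    apply/seteqP; split=> // i _ /=; rewrite /Phi (functional0 (mu_lin i)).
    rewrite (_ : cmul 0 0 = 0) ?(functional0 (lam_lin i)); first lra.
    by apply: cspaceP => t; rewrite !cspaceE mulr0.
  exists L => s [h] /infinite_setN0[i /= /ltW sPhi]; exact: le_trans (Phi_le i h).
pose sigma := sup levels.
(* A perturbation of size [tau] gains [2 tau (mu i g - q i g)] to first order and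
   loses at most [tau^2 L]; the choices below make [delta / tau] and [tau L / 2]
   equal to [eta / 2]. *)
pose tau := eta / L; pose delta := eta ^+ 2 / (2 * L).
have tau0 : 0 < tau by rewrite divr_gt0.
have delta0 : 0 < delta by rewrite divr_gt0 ?exprn_gt0 ?mulr_gt0.
have [s [h hinf] hs] := sup_adherent delta0 levels_sup.
pose B0 := [set i | s < Phi i h].
pose q i g := lam i (cmul h g).
have q_lin i a u v : q i (a *: u + v) = a * q i u + q i v.
  rewrite /q -lam_lin; congr (lam i _); apply: cspaceP => t.
  by rewrite !cspaceE; ring.
have near_mu g : `|g| <= 1 -> finite_set [set i | B0 i /\ eta < mu i g - q i g].
  move=> g1; pose h' := tau *: g + h.
  have fin : finite_set [set i | sigma + delta < Phi i h'].
    apply: contrapT => inf; have : sigma + delta <= sigma.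
      by apply: ub_le_sup; [case: levels_sup|exists h'].
    by rewrite leNgt ltrDl delta0.
  apply: sub_finite_set fin => i /= [B0i etalt].
  have -> : Phi i h' = Phi i h + 2 * tau * (mu i g - q i g) - tau ^+ 2 * lam i (cmul g g).
    rewrite /Phi /h' mu_lin.
    rewrite (_ : cmul _ _ = cmul h h + (2 * tau) *: cmul h g + tau ^+ 2 *: cmul g g).
      by rewrite !(functionalD (lam_lin i)) !(functionalZ (lam_lin i)) /q; ring.
    by apply: cspaceP => t; rewrite !cspaceE; ring.
  have gg : lam i (cmul g g) <= L.
    rewrite -[leRHS]mulr1; apply: lam_le => // t /=.
    have := le_trans (cspace_norm_ge g t) g1; rewrite ler_norml => /andP[? ?]; nra.
  have Ltau : tau * L = eta by rewrite /tau divfK ?gt_eqF.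
  have tau2 : tau ^+ 2 * lam i (cmul g g) <= tau * eta.
    by rewrite expr2 -mulrA ler_pM2l// -Ltau ler_pM2l.
  have deltaE : 2 * delta = tau * eta.
    by rewrite /delta /tau; field; rewrite gt_eqF.
  have : tau * eta < tau * (mu i g - q i g) by rewrite ltr_pM2l.
  rewrite /B0 /= in B0i; rewrite -/sigma in hs; lra.
(* The same [tau] serves as cutoff for the sign of [h], as [lam i tau <= eta]. *)
pose g0 := cspace_of (@csign_continuous R T tau h tau0).
have g0E t : g0 t = h t / (`|h t| + tau) by [].
have den t : 0 < `|h t| + tau by rewrite ltr_wpDl.
have g0_le1 : `|g0| <= 1.
  apply: cspace_norm_le => // t; rewrite g0E normrM normfV (gtr0_norm (den t)).
  by rewrite ler_pdivrMr// mul1r lerDl ltW.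
have h_le t : `|h t| <= h t * g0 t + tau.
  rewrite g0E mulrA -expr2 -(@real_normK _ (h t)) ?num_real//.
  rewrite -lerBlDr ler_pdivlMr//; have := sqr_ge0 tau; rewrite !expr2; nra.
pose bad := [set i | C < mu i g0] `|` [set i | B0 i /\ eta < mu i (- g0) - q i (- g0)].
have bad_fin : finite_set bad.
  by rewrite finite_setU; split; [exact: mu_asymptotic|apply: near_mu; rewrite normrN].
have lam_h i : B0 i -> ~ bad i -> q i g0 + lam i (ccst T tau) <= C + 2 * eta.
  move=> B0i /not_orP[/negP + /not_andP[//|/negP]].
  rewrite -!leNgt (functionalN (mu_lin i)) (functionalN (q_lin i)) => ? ?.
  have : lam i (ccst T tau) <= L * tau by apply: lam_le => //; exact: ltW.
  by rewrite (mulrC L) /tau divfK ?gt_eqF//; lra.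
have q_bound i g : B0 i -> ~ bad i -> q i g <= (C + 2 * eta) * `|g|.
  move=> B0i nbad; apply: (@le_trans _ _ (lam i (`|g| *: (cmul h g0 + ccst T tau)))).
    apply: lam_mono => t; rewrite !cspaceE; apply: (le_trans (ler_norm _)).
    by rewrite normrM mulrC ler_pM// ?cspace_norm_ge// h_le.
  rewrite (functionalZ (lam_lin i)) (functionalD (lam_lin i)) mulrC ler_wpM2r//.
  exact: lam_h.
exists (B0 `\` bad), q; split=> //.
- by apply: infinite_setD.
- move=> i g [B0i nbad]; rewrite ler_norml q_bound// andbT lerNl.
  by rewrite -(functionalN (q_lin i)) -(normrN g) q_bound.
- move=> g g1; apply: sub_finite_set (near_mu g g1) => i /= [[? _] ?]; split=> //.
Qed.

End AsymptoticDecomposition.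

(** * Spaces of ultrafilters *)

Section UltrafilterSpace.
Variables (M : Type) (P : set M).

(** The Stone-Cech compactification of the discrete space [M], minus the
    isolated points in [P]; the remainder of [M] is obtained for [P] full. *)
Record ultrafilter_off := UltrafilterOff {
  uset :> set M -> Prop;
  uset0 : ~ uset set0;
  usetI : forall A B, uset A -> uset B -> uset (A `&` B);
  usetS : forall A B, A `<=` B -> uset A -> uset B;
  usetC : forall A, uset A \/ uset (~` A);
  uset_off : forall p, P p -> ~ uset [set p]
}.

HB.instance Definition _ := gen_eqMixin ultrafilter_off.
HB.instance Definition _ := gen_choiceMixin ultrafilter_off.

Implicit Types u v : ultrafilter_off.

Lemma ultrafilter_off_eq u v : (forall A, u A -> v A) -> u = v.
Proof.
move=> uv; have {uv} e : uset u = uset v.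
  apply/seteqP; split=> // A vA; have [//|/uv vCA] := usetC u A.
  by case: (uset0 (u := v)); rewrite -(setICr A); exact: usetI.
case: u v e => [u ? ? ? ? ?] [v ? ? ? ? ?] /= e; move: e => e; subst v.
by congr UltrafilterOff; exact: Prop_irrelevance.
Qed.

Lemma usetCN u A : u (~` A) <-> ~ u A.
Proof.
split=> [uCA uA|]; last by have [] := usetC u A.
by apply: (uset0 (u := u)); rewrite -(setICr A); exact: usetI.
Qed.

Lemma usetT u : u setT.
Proof. by have [//|] := usetC u setT; rewrite setCT => /uset0. Qed.

Lemma usetU u A B : u (A `|` B) <-> u A \/ u B.
Proof.
split=> [uAB|[]]; [|exact/usetS/subsetUl|exact/usetS/subsetUr].
have [|/usetCN uA] := pselect (u A); first by left.
have [|/usetCN uB] := pselect (u B); first by right.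
by have := usetI uAB (usetI uA uB); rewrite -setCU setICr => /uset0.
Qed.

Let clopen_cover : \bigcup_(A in [set: set M]) [set u : ultrafilter_off | u A] = setT.
Proof. by apply/seteqP; split=> // u _; exists setT => //; exact: usetT. Qed.

Let clopen_join A B u : setT A -> setT B -> [set u | uset u A] u -> [set u | uset u B] u ->
  exists D, [/\ setT D, [set u | uset u D] u &
                [set u | uset u D] `<=` [set u | uset u A] `&` [set u | uset u B]].
Proof.
move=> _ _ uA uB; exists (A `&` B); split=> //; first exact: usetI.
by move=> v /= vAB; split; apply: usetS vAB; [exact: subIsetl|exact: subIsetr].
Qed.

HB.instance Definition _ :=
  isBaseTopological.Build ultrafilter_off clopen_cover clopen_join.

Lemma nbhs_ultrafilter u (N : set ultrafilter_off) :
  nbhs u N <-> exists2 A, u A & [set v | uset v A] `<=` N.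
Proof.
rewrite nbhsE; split=> [[O [[D _ DO] Ou] ON]|[A uA AN]].
  have [A DA uA] : (\bigcup_(A in D) [set v | uset v A]) u by rewrite DO.
  by exists A => //; apply: subset_trans ON; rewrite -DO => v vA; exists A.
exists [set v | uset v A] => //; split=> //.
by exists [set A] => //; rewrite bigcup_set1.
Qed.

(** An ultrafilter [F] of ultrafilters converges to its average, made of the
    sets [A] which belong to [F]-almost every ultrafilter. *)
Lemma ultrafilter_off_compact : compact [set: ultrafilter_off].
Proof.
rewrite compact_ultra => F FU _.
have F0 : ~ F set0 by exact: filter_not_empty.
have FC A : F [set u : ultrafilter_off | u (~` A)] <-> ~ F [set u : ultrafilter_off | u A].
  rewrite (_ : [set u | uset u (~` A)] = ~` [set u | uset u A]); last first.
    by apply/seteqP; split=> u /= /usetCN.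
  split=> [FA FB|]; last by have [] := in_ultra_setVsetC [set u : ultrafilter_off | u A] FU.
  by apply: F0; rewrite -(setICr [set u : ultrafilter_off | u A]); exact: filterI.
have lim0 : ~ F [set u : ultrafilter_off | u set0].
  by rewrite (_ : [set u | _] = set0)//; apply/seteqP; split=> // u /uset0.
have limI A B : F [set u : ultrafilter_off | u A] -> F [set u : ultrafilter_off | u B] ->
    F [set u : ultrafilter_off | u (A `&` B)].
  by apply: filterS2 => u; exact: usetI.
have limS A B : A `<=` B -> F [set u : ultrafilter_off | u A] -> F [set u : ultrafilter_off | u B].
  by move=> AB; apply: filterS => u; exact: usetS.
have limC A : F [set u : ultrafilter_off | u A] \/ F [set u : ultrafilter_off | u (~` A)].
  by have [|/FC] := pselect (F [set u : ultrafilter_off | u A]); [left|right].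
have lim_off p : P p -> ~ F [set u : ultrafilter_off | u [set p]].
  by move=> Pp; apply/FC; apply: (@filterS _ F _ setT) filterT => u _;
    apply/usetCN; exact: uset_off.
exists (UltrafilterOff lim0 limI limS limC lim_off); split=> // N.
by move=> /nbhs_ultrafilter[A FA AN]; exact: (@filterS _ F _ _ _ AN FA).
Qed.

Lemma ultrafilter_off_hausdorff : hausdorff_space ultrafilter_off.
Proof.
move=> u v uv; apply: ultrafilter_off_eq => A uA; apply: contrapT => /usetCN vA.
have [w []/=] := uv [set w | uset w A] [set w | uset w (~` A)]
  (proj2 (nbhs_ultrafilter u _) (ex_intro2 _ _ A uA (fun _ => id)))
  (proj2 (nbhs_ultrafilter v _) (ex_intro2 _ _ _ vA (fun _ => id))).
by move=> ? /usetCN.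
Qed.

HB.instance Definition _ := Topological_isCompactHausdorff.Build ultrafilter_off
  ultrafilter_off_compact ultrafilter_off_hausdorff.

Variable R : realType.

Lemma uset_indicator_continuous A :
  continuous (fun u : ultrafilter_off => (`[< u A >])%:R : R).
Proof.
move=> u N /nbhs_singleton /= Nu; apply/nbhs_ultrafilter.
have [uA|uA] := pselect (u A).
  by exists A => // v vA /=; rewrite (asboolT vA); rewrite asboolT in Nu.
exists (~` A); first exact/usetCN.
by move=> v /usetCN vA /=; rewrite (asboolF vA); rewrite asboolF in Nu.
Qed.

Definition uindic A : cspace ultrafilter_off R := cspace_of (@uset_indicator_continuous A).

Lemma uindicE A u : uindic A u = (`[< u A >])%:R.
Proof. by []. Qed.

End UltrafilterSpace.

Arguments uindic {M P} R A.

Lemma uset_finite (M : eqType) (P : set M) (u : ultrafilter_off P) (A : set M) :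
  finite_set A -> A `<=` P -> ~ u A.
Proof.
move=> /finite_seqP[s ->{A}]; elim: s => [|x s IHs] sP.
  by rewrite (_ : [set` _] = set0); [exact: uset0|by apply/seteqP; split].
have -> : [set` x :: s] = [set x] `|` [set` s].
  apply/seteqP; split=> y /=; rewrite inE; first by move=> /orP[/eqP|]; [left|right].
  by move=> [->|->]; rewrite ?eqxx ?orbT.
move=> /usetU[|]; first by apply: uset_off; apply: sP; rewrite /= mem_head.
by apply: IHs => y ys; apply: sP; rewrite /= inE ys orbT.
Qed.

(** Extend the filter of the sets that contain almost all of [I]. *)
Lemma free_ultrafilter (I : set nat) : infinite_set I ->
  exists W : ultrafilter_off [set: nat], W I.
Proof.
move=> Iinf; pose F := [set A : set nat | finite_set (I `\` A)].
have FF : ProperFilter F.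
  split; first by rewrite /F /= setD0.
  split=> [|A B FA FB|A B AB]; rewrite /F /=.
  - by rewrite setDT.
  - by rewrite setDIr finite_setU.
  - by apply: sub_finite_set; exact: setDS.
have [G [GU FG]] := ultraFilterLemma FF.
have GP : ProperFilter G by exact: ultra_proper.
have G0 : ~ G set0 by exact: filter_not_empty.
have G_off p : [set: nat] p -> ~ G [set p].
  move=> _ Gp; apply: G0; rewrite -(setICr [set p]); apply: filterI => //.
  by apply: FG; rewrite /F /= setDE setCK; exact: finite_setIr.
have GS A B : A `<=` B -> G A -> G B by move=> AB; exact: filterS.
exists (UltrafilterOff G0 (@filterI _ G _) GS (fun A => in_ultra_setVsetC A GU) G_off).
by apply: FG; rewrite /F /= setDv.
Qed.

(** * The G-space *)

Section BenyaminiSpace.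
Variable R : realType.

(** The triple [(n, i, false)] is the [i]-th coordinate of the [n]-th summand; the
    triples [(n, i, true)] only serve to provide, by removing them, the copy of
    the remainder which is attached to the [n]-th summand. *)
Definition benyamini_index := (nat * nat * bool)%type.

Definition benyamini_off : set benyamini_index := [set m | m.2 = true].

Definition benyamini_compact : compactHausdorffType := ultrafilter_off benyamini_off.

Local Notation S := benyamini_compact.

Definition slice n b (A : set nat) : set benyamini_index :=
  [set m | [/\ m.1.1 = n, A m.1.2 & m.2 = b]].

Section PrincipalPoint.
Variables n i : nat.
Let u (A : set benyamini_index) : Prop := A (n, i, false).
Let u_I A B : u A -> u B -> u (A `&` B). Proof. by []. Qed.
Let u_S A B : A `<=` B -> u A -> u B. Proof. exact. Qed.
Let u_C A : u A \/ u (~` A). Proof. exact: EM. Qed.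
Let u_off p : benyamini_off p -> ~ u [set p].
Proof. by case: p => -[m j] b; rewrite /benyamini_off /u /= => ->. Qed.
Definition principal : S := UltrafilterOff (fun f : u set0 => f) u_I u_S u_C u_off.
End PrincipalPoint.

Section LimitPoint.
Variables (n : nat) (b : bool) (W : ultrafilter_off [set: nat]).
Let u (A : set benyamini_index) : Prop := W [set i | A (n, i, b)].
Let u_0 : ~ u set0. Proof. exact: uset0. Qed.
Let u_I A B : u A -> u B -> u (A `&` B). Proof. exact: usetI. Qed.
Let u_S A B : A `<=` B -> u A -> u B.
Proof. by move=> AB; apply: usetS => i; exact: AB. Qed.
Let u_C A : u A \/ u (~` A). Proof. exact: (usetC W). Qed.
Let u_off p : benyamini_off p -> ~ u [set p].
Proof.
by move=> _ up; apply: (@uset_off _ _ W p.1.2) => //; apply: usetS up => i /= <-.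
Qed.
Definition limit_point : S := UltrafilterOff u_0 u_I u_S u_C u_off.
End LimitPoint.

Lemma limit_pointE n b W (A : set benyamini_index) :
  limit_point n b W A = W [set i | A (n, i, b)].
Proof. by []. Qed.

Definition weight n : R := n.+1%:R^-1.

Lemma weight_gt0 n : 0 < weight n.
Proof. by rewrite invr_gt0. Qed.

Lemma weight_le1 n : weight n <= 1.
Proof. by rewrite invf_le1// ler1n. Qed.

Definition benyamini : set (cspace S R) := [set f | forall n W,
  f (limit_point n false W) = weight n * f (limit_point n true W)].

Definition relations : set (S * S * R) :=
  [set p | exists n W, p = (limit_point n false W, limit_point n true W, weight n)].

Lemma benyaminiE : benyamini = [set f | forall s1 s2 lambda,
  relations (s1, s2, lambda) -> f s1 = lambda * f s2].
Proof.
apply/seteqP; split=> [f Ef s1 s2 lambda [n [W [-> -> ->]]]|f Ef n W]; first exact: Ef.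
by apply: Ef; exists n, W.
Qed.

Lemma benyamini_submod : submod_closed [in benyamini].
Proof.
split=> [|a f g]; rewrite !inE; first by move=> n W; rewrite !cspaceE mulr0.
by move=> Ef Eg n W; rewrite !cspaceE Ef Eg; ring.
Qed.

Lemma benyamini_closed : closed benyamini.
Proof.
move=> f fE n W; apply/eqP; rewrite -subr_eq0 -normr_le0.
apply/ler_addgt0Pr => e e0; rewrite add0r.
have [g [Eg]] := fE (ball f (e / 2)) (nbhsx_ballx _ _ (divr_gt0 e0 (ltr0Sn R 1))).
rewrite -ball_normE /= => /ltW fg.
set s := limit_point _ _ _; set s' := limit_point _ _ _.
have -> : f s - weight n * f s' = (f - g) s - weight n * (f - g) s'.
  by rewrite !cspaceE Eg -/s -/s'; ring.
rewrite (le_trans (ler_normB _ _))// [leRHS]splitr lerD//.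
  exact: le_trans (cspace_norm_ge _ _) fg.
rewrite normrM (gtr0_norm (weight_gt0 n)) -[leRHS]mul1r ler_pM ?weight_le1//.
  exact/ltW/weight_gt0.
exact: le_trans (cspace_norm_ge _ _) fg.
Qed.

Lemma benyamini_G_space : is_G_space benyamini.
Proof.
split; first by split; [exact: benyamini_submod|exact: benyamini_closed].
by exists relations; exact: benyaminiE.
Qed.

(** A cluster point of the isolated points of the [n]-th summand is tied to a
    point of the remainder, where [f] takes a value [n + 1] times as large, and
    at most [|f|]. *)
Lemma principal_asymptotic n f : benyamini f ->
  finite_set [set i | `|f| + 1 < n.+1%:R * f (principal n i)].
Proof.
move=> Ef; apply: contrapT => /free_ultrafilter[W WI].
pose s := limit_point n false W.
have fs : n.+1%:R * f s <= `|f|.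
  rewrite Ef mulrA /weight mulfV ?pnatr_eq0// mul1r.
  exact: le_trans (ler_norm _) (cspace_norm_ge _ _).
have : nbhs s [set x | f x < f s + weight n].
  have /cvgrPdist_lt/(_ _ (weight_gt0 n)) := @cspace_continuous S R f s.
  by apply: filterS => x /=; rewrite distrC ltr_distl => /andP[].
move=> /nbhs_ultrafilter[A sA Af].
have /(usetI WI) : W [set i | A (n, i, false)] by [].
have [[i [/= fi Ai]]|] := pselect
    ([set i | `|f| + 1 < n.+1%:R * f (principal n i)] `&` [set i | A (n, i, false)] !=set0).
  have := Af (principal n i) Ai; rewrite /= -(ltr_pM2l (ltr0Sn R n)).
  rewrite mulrDr /weight mulfV ?pnatr_eq0//; lra.
by move=> /nonemptyPn ->; move/uset0.
Qed.

(** The element of the [n]-th summand [X_n] given by the indicator sequence of [A]: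
    its values at the isolated points carry the factor [1 / (n + 1)]. *)
Definition indic n A : cspace S R :=
  weight n *: uindic R (slice n false A) + uindic R (slice n true A).

Lemma indicE n A u : indic n A u =
  weight n * (`[< u (slice n false A) >])%:R + (`[< u (slice n true A) >])%:R.
Proof. by []. Qed.

Lemma indic_benyamini n A : benyamini (indic n A).
Proof.
move=> m W; rewrite !indicE !limit_pointE.
have -> : [set i | slice n true A (m, i, false)] = set0.
  by apply/seteqP; split=> // i [].
have -> : [set i | slice n false A (m, i, true)] = set0.
  by apply/seteqP; split=> // i [].
have -> : [set i | slice n false A (m, i, false)] = [set i | m = n /\ A i].
  by apply/seteqP; split=> i /= [].
have -> : [set i | slice n true A (m, i, true)] = [set i | m = n /\ A i].
  by apply/seteqP; split=> i /= [].
rewrite (asboolF (@uset0 _ _ W)) mulr0 add0r addr0.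
have [->//|mn] := eqVneq m n.
rewrite (_ : [set i | _ /\ _] = set0) ?(asboolF (@uset0 _ _ W)) ?mulr0//.
by apply/seteqP; split=> // i [/eqP]; rewrite (negbTE mn).
Qed.

Lemma indic_norm_le1 n A : `|indic n A| <= 1.
Proof.
apply: cspace_norm_le => // u; rewrite indicE.
have w0 := weight_gt0 n; have w1 := weight_le1 n.
have [uA|uA] := pselect (u (slice n true A)).
  rewrite (asboolT uA) asboolF ?mulr0 ?add0r ?normr1// => uA'.
  apply: (uset0 (u := u)); rewrite (_ : set0 = slice n false A `&` slice n true A).
    exact: usetI.
  by apply/seteqP; split=> // m [[_ _ m2] [_ _]]; rewrite m2.
rewrite (asboolF uA) addr0; case: asboolP => _; rewrite ?mulr1 ?mulr0 ?normr0//.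
by rewrite gtr0_norm.
Qed.

(** The indicator of a finite set vanishes on the remainder. *)
Lemma indic_finite n A : finite_set A -> `|indic n A| <= weight n.
Proof.
move=> Afin; have w0 := weight_gt0 n.
apply: cspace_norm_le => [|u]; first exact: ltW.
rewrite indicE [in X in _ + X]asboolF ?addr0; last first.
  apply: uset_finite; last by move=> m [].
  apply: (@sub_finite_set _ _ ((fun i => (n, i, true)) @` A)); last exact: finite_image.
  by move=> [[_ i] _] [/= -> Ai ->]; exists i.
by case: asboolP => _; rewrite ?mulr1 ?mulr0 ?normr0 ?gtr0_norm// ltW.
Qed.

Lemma indicU n A B : A `&` B = set0 -> indic n (A `|` B) = indic n A + indic n B.
Proof.
move=> AB0; apply: cspaceP => u; rewrite !cspaceE !uindicE.
have addb b : (`[< u (slice n b (A `|` B)) >])%:R =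
    (`[< u (slice n b A) >])%:R + (`[< u (slice n b B) >])%:R :> R.
  have -> : slice n b (A `|` B) = slice n b A `|` slice n b B.
    apply/seteqP; split=> m /=; first by move=> [? [|] ?]; [left|right].
    by move=> [[? ? ?]|[? ? ?]]; split=> //; [left|right].
  have [uA|uA] := pselect (u (slice n b A)).
    rewrite (asboolT uA) asboolT; last by apply/usetU; left.
    rewrite asboolF ?addr0// => uB; apply: (uset0 (u := u)).
    rewrite (_ : set0 = slice n b A `&` slice n b B); first exact: usetI.
    apply/seteqP; split=> // m [[_ Am _] [_ Bm _]].
    by have : (A `&` B) m.1.2 by []; rewrite AB0.
  rewrite (asboolF uA) add0r; congr (_%:R); congr nat_of_bool; apply: asbool_equiv_eq.
  by rewrite usetU; split=> [[]//|]; right.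
by rewrite !addb; ring.
Qed.

Lemma indic_principal n A i : indic n A (principal n i) = weight n * (`[< A i >])%:R.
Proof.
rewrite indicE [in X in _ + X]asboolF ?addr0; last by case.
by congr (_ * (nat_of_bool _)%:R); apply: asbool_equiv_eq; split=> [[]|].
Qed.

End BenyaminiSpace.

(** * Uncountable almost disjoint families *)

(** Cantor's diagonal argument. *)
Lemma no_injection_sets (f : set nat -> nat) : ~ injective f.
Proof.
move=> finj; pose D := [set n | exists2 A, f A = n & ~ A n].
have DE : D (f D) <-> ~ D (f D).
  split=> [[A fA nA]|nD]; last by exists D.
  by rewrite (finj _ _ fA) in nA.
have nD : ~ D (f D) by move=> DD; exact: (DE.1 DD DD).
exact: (nD (DE.2 nD)).
Qed.

Section AlmostDisjointFamily.

Variable e : nat -> nat.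
Hypothesis e_inj : injective e.

Let prefix (X : set nat) k := mkseq (fun i => `[< X i >]) k.

(** The sets [branch X] are the branches of the binary tree, whose nodes are
    encoded as integers and then mapped by [e] into a prescribed infinite set. *)
Definition branch (X : set nat) : set nat := range (fun k => e (pickle (prefix X k))).

Lemma branch_infinite X : infinite_set (branch X).
Proof.
have inj : {in [set: nat] &, injective (fun k => e (pickle (prefix X k)))}.
  move=> k l _ _ /e_inj /(pcan_inj pickleK) /(congr1 size).
  by rewrite !size_mkseq.
by rewrite /branch (eq_finite_set (inj_card_eq inj)); exact: infinite_nat.
Qed.

Lemma branch_almost_disjoint X Y : X != Y -> finite_set (branch X `&` branch Y).
Proof.
move=> XY; have [i Xi] : exists i, ~ (X i <-> Y i).
  apply: contrapT => /forallNP H; move/eqP: XY; apply; apply/funext => i.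
  by apply/propext; apply: contrapT; exact: H.
apply: (@sub_finite_set _ _ ((fun k => e (pickle (prefix X k))) @` `I_i.+1)); last first.
  exact: finite_image.
move=> _ [[k _ <-] [l _ /e_inj /(pcan_inj pickleK) YX]].
have lk : l = k by move/(congr1 size): YX; rewrite !size_mkseq.
exists k => //=; rewrite ltnS leqNgt; apply/negP => ik; apply: Xi; subst l.
have := congr1 (nth false ^~ i) YX; rewrite !nth_mkseq// => YXi.
by split=> [Xi|Yi]; apply/asboolP; [rewrite YXi|rewrite -YXi]; apply/asboolP.
Qed.

End AlmostDisjointFamily.

(** * Norm bounds for isomorphisms *)

Section LinearBounds.
Variable R : realType.

Lemma continuous_linear_bound (V W : normedModType R) (E : set V) (f : V -> W) :
  submod_closed [in E] ->
  (forall (a : R) u v, E u -> E v -> f (a *: u + v) = a *: f u + f v) ->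
  {within E, continuous f} ->
  exists2 C, 0 < C & forall x, E x -> `|f x| <= C * `|x|.
Proof.
move=> [E0 Elin] f_lin /subspace_continuousP fcont; rewrite inE in E0.
have EZ a x : E x -> E (a *: x).
  by move=> Ex; have := Elin a x 0; rewrite !inE addr0; apply.
have f0 : f 0 = 0 by have := f_lin 1 0 0 E0 E0; rewrite !scale1r addr0 -[LHS]addr0 => /addrI.
have fZ a x : E x -> f (a *: x) = a *: f x.
  by move=> Ex; rewrite -[a *: x]addr0 f_lin// f0 addr0.
have /cvgrPdist_lt/(_ 1 ltr01) := fcont 0 E0.
move=> /nbhs_ballP[d /= d0 df].
have {}df y : `|y| < d -> E y -> `|f y| < 1.
  move=> yd Ey; have <- : `|f 0 - f y| = `|f y| by rewrite f0 sub0r normrN.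
  by apply: df => //; rewrite -ball_normE /= sub0r normrN.
exists (2 / d) => [|x Ex]; first by rewrite divr_gt0.
have [->|x0] := eqVneq x 0; first by rewrite f0 !normr0 mulr0.
have nx0 : 0 < `|x| by rewrite normr_gt0.
pose a := d / (2 * `|x|); have a0 : 0 < a by rewrite divr_gt0// mulr_gt0.
have ax : `|a *: x| = d / 2 by rewrite normrZ gtr0_norm// /a; field; rewrite gt_eqF.
have : `|f (a *: x)| < 1.
  by apply: df; [rewrite ax gtr_pMr// invf_lt1// ltr1n|exact: EZ].
rewrite fZ// normrZ gtr0_norm// => /ltW.
rewrite mulrC -ler_pdivlMr// /a => /le_trans; apply.
by rewrite le_eqVlt; apply/orP; left; apply/eqP; field; rewrite !gt_eqF.
Qed.

Lemma isomorphic_bounds (V W : normedModType R) (E : set V) :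
  submod_closed [in E] -> isomorphic E [set: W] ->
  exists phi psi C,
   [/\ 0 < C,
       forall (a : R) u v, E u -> E v -> phi (a *: u + v) = a *: phi u + phi v,
       forall x, E x -> psi (phi x) = x /\ `|phi x : W| <= C * `|x|,
       forall (a : R) u v, psi (a *: u + v) = a *: psi u + psi v &
       forall y, E (psi y) /\ `|psi y| <= C * `|y|].
Proof.
move=> Esub [phi [psi [[phiE psiE phiK psiK] [phi_lin phi_cont psi_cont]]]].
have [C1 C10 phi_le] := continuous_linear_bound Esub phi_lin phi_cont.
have Epsi y : E (psi y) by exact: psiE.
have psi_lin a u v : psi (a *: u + v) = a *: psi u + psi v.
  have Euv : E (a *: psi u + psi v).
    by have := Esub.2 a (psi u) (psi v); rewrite !inE; apply.
  rewrite -[RHS]phiK ?inE// phi_lin// !psiK ?inE//.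
have Tsub : submod_closed [in [set: W]] by split=> [|a u v _ _]; rewrite inE.
have [C2 C20 psi_le] := continuous_linear_bound Tsub (fun a u v _ _ => psi_lin a u v) psi_cont.
exists phi, psi, (C1 + C2); split=> //.
- exact: addr_gt0.
- move=> x Ex; split; first by rewrite phiK ?inE.
  by rewrite (le_trans (phi_le x Ex))// ler_wpM2r// lerDl ltW.
- move=> y; split=> //.
  by rewrite (le_trans (psi_le y Logic.I))// ler_wpM2r// lerDr ltW.
Qed.

End LinearBounds.

(** * Sums of almost disjoint indicators, and nonseparability *)

Section IndicatorSums.
Variable R : realType.
Local Notation S := benyamini_compact.

Lemma indic0 n : indic R n set0 = 0.
Proof. by apply: (@addrI _ (indic R n set0)); rewrite -indicU ?setI0// setU0 addr0. Qed.

(** Disjoint sets would give no error term; each new set meets the union of the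
    previous ones in a finite set, whose indicator has norm at most
    [1 / (n + 1)]. *)
Lemma sum_indic (I : choiceType) (A : I -> set nat) n (s : seq I) : uniq s ->
  (forall x y, x != y -> finite_set (A x `&` A y)) ->
  exists r : cspace S R, [/\ benyamini r, `|r| <= (size s)%:R * weight R n &
    \sum_(x <- s) indic R n (A x) = indic R n (\bigcup_(x in [set` s]) A x) + r].
Proof.
move=> + Afin; elim: s => [_|x s IHs /= /andP[xs /IHs[r [Er rle rE]]]].
  exists 0; rewrite big_nil mul0r normr0 addr0; split=> //.
    by have := (benyamini_submod R).1; rewrite inE.
  rewrite (_ : \bigcup_(x in _) _ = set0) ?indic0//.
  by apply/seteqP; split=> // i [].
have -> : [set` x :: s] = x |` [set` s].
  apply/seteqP; split=> y /=; rewrite inE; first by move=> /orP[/eqP|]; [left|right].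
  by move=> [->|->]; rewrite ?eqxx ?orbT.
rewrite bigcup_setU1; set U := \bigcup_(y in [set` s]) A y in rE *.
have fin : finite_set (A x `&` U).
  rewrite setI_bigcupr; apply: bigcup_finite => // y /= ys; apply: Afin.
  by apply: contraNneq xs => ->.
exists (indic R n (A x `&` U) + r); split.
- have := (benyamini_submod R).2 1 (indic R n (A x `&` U)) r.
  by rewrite !inE scale1r; apply=> //; exact: indic_benyamini.
- rewrite (le_trans (ler_normD _ _))// -add1n natrD mulrDl mul1r lerD//.
  exact: indic_finite.
- rewrite big_cons rE -{1}(setUIDK (A x) U) indicU; last by rewrite setDE setIACA setICr setI0.
  rewrite setUC (_ : U `|` A x = U `|` A x `\` U); last first.
    by apply/seteqP; split=> i [Ui|]; [left|have [|] := EM (U i); [left|right]|left|case; right].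
  rewrite indicU ?setDIK//.
  by rewrite (addrC (indic R n (_ `&` _))) addrACA (addrC (indic R n (_ `\` _))).
Qed.

(** The indicators in the summand [X_0], whose weight is 1, form an uncountable
    family at mutual distance at least 1. *)
Lemma benyamini_not_separable : ~ separable (@benyamini R).
Proof.
move=> [D [DE /countable_injP[f f_inj] Ddense]].
have /choice[d dP] X : exists d, D d /\ `|indic R 0 X - d| < 1 / 2.
  have [d [Dd]] := Ddense _ (indic_benyamini R 0 X) (ball (indic R 0 X) (1 / 2))
    (nbhsx_ballx _ _ (divr_gt0 ltr01 (ltr0Sn R 1))).
  by rewrite -ball_normE; exists d.
apply: (@no_injection_sets (f \o d)) => X Y /= fXY.
have dXY : d X = d Y by apply: f_inj; rewrite ?inE//; [have [] := dP X|have [] := dP Y].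
apply/funext => i; apply/propext.
have : `|(indic R 0 X - indic R 0 Y) (principal 0 i)| < 1.
  apply: (le_lt_trans (cspace_norm_ge _ _)); apply: (le_lt_trans (ler_distD (d X) _ _)).
  rewrite [ltRHS]splitr ltrD//; first by have [] := dP X.
  by rewrite distrC dXY; have [] := dP Y.
rewrite cspaceDE cspaceNE !indic_principal /weight invr1 !mul1r.
case: asboolP => Xi; case: asboolP => Yi; rewrite ?subr0 ?sub0r ?normrN ?normr1 ?ltxx//.
Qed.

End IndicatorSums.

(** * The G-space is not a C-space *)

Section NotIsomorphic.
Variables (R : realType) (T : compactHausdorffType).
Local Notation S := benyamini_compact.
Local Notation E := (@benyamini R).
Variables (phi : cspace S R -> cspace T R) (psi : cspace T R -> cspace S R) (C : R).
Hypothesis C0 : 0 < C.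
Hypothesis phi_lin : forall a u v, E u -> E v -> phi (a *: u + v) = a *: phi u + phi v.
Hypothesis phiK : forall f, E f -> psi (phi f) = f.
Hypothesis phi_bound : forall f, E f -> `|phi f| <= C * `|f|.
Hypothesis psi_lin : forall a u v, psi (a *: u + v) = a *: psi u + psi v.
Hypothesis psi_benyamini : forall g, E (psi g).
Hypothesis psi_bound : forall g, `|psi g| <= C * `|g|.

Lemma benyamini_sum (I : Type) (s : seq I) (f : I -> cspace S R) :
  (forall i, E (f i)) -> E (\sum_(i <- s) f i) /\
  phi (\sum_(i <- s) f i) = \sum_(i <- s) phi (f i).
Proof.
have [E0 Elin] := benyamini_submod R; rewrite inE in E0.
have phi0 : phi 0 = 0.
  by have := phi_lin 1 E0 E0; rewrite !scale1r addr0 -[LHS]addr0 => /addrI.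
move=> Ef; elim: s => [|i s [Es IHs]]; first by rewrite !big_nil.
rewrite !big_cons -IHs -[f i]scale1r phi_lin ?scale1r//; split=> //.
by have := Elin 1 (f i) (\sum_(j <- s) f j); rewrite !inE scale1r; apply.
Qed.

(* [D] bounds the norms of the functionals [q i] composed with [phi]. It depends
   on [C] alone, and [n] is chosen such that [D / (n + 1) <= 1/4]. *)
Let eta : R := (4 * C)^-1.
Let D : R := (C + 1 + 2 * eta) * C.
Let n : nat := Num.trunc (4 * D).
Let mu i (g : cspace T R) : R := n.+1%:R * psi g (principal n i).

Let eta0 : 0 < eta. Proof. by rewrite invr_gt0 mulr_gt0. Qed.

Let D0 : 0 < D.
Proof. by rewrite mulr_gt0// !addr_gt0// mulr_gt0. Qed.

Let D_weight : D * weight R n <= 1 / 4.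
Proof.
have : 4 * D <= n.+1%:R by apply/ltW/truncnS_gt.
by rewrite /weight ler_pdivrMr// => ?; lra.
Qed.

(** By [large], each set of an uncountable almost disjoint family is detected by
    some functional [q i], while by [few] each [q i] detects finitely many. *)
Lemma no_isomorphism_to_C : False.
Proof.
have mu_lin i a u v : mu i (a *: u + v) = a * mu i u + mu i v.
  by rewrite /mu psi_lin !cspaceE; ring.
have mu_bound i g : `|mu i g| <= (n.+1%:R * C) * `|g|.
  rewrite /mu normrM normr_nat -mulrA ler_pM2l//.
  exact: le_trans (cspace_norm_ge _ _) (psi_bound g).
have mu_asymp g : `|g| <= 1 -> finite_set [set i | C + 1 < mu i g].
  move=> g1; apply: sub_finite_set (principal_asymptotic n (psi_benyamini g)) => i /=.
  apply: le_lt_trans; rewrite lerD2r (le_trans (psi_bound g))//.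
  by rewrite -[leRHS]mulr1 ler_pM2l.
have [] := @asymptotic_decomposition R T mu (n.+1%:R * C) (C + 1) eta
  mu_lin mu_bound mu_asymp _ eta0; first by rewrite mulr_gt0.
move=> B [q [Binf q_lin q_bound q_near]].
have Q_bound i f : B i -> E f -> q i (phi f) <= D * `|f|.
  move=> Bi Ef; apply: (le_trans (ler_norm _)); apply: (le_trans (q_bound i _ Bi)).
  rewrite /D -mulrA ler_wpM2l ?phi_bound//.
  by rewrite !addr_ge0// ?mulr_ge0// ltW.
have /infiniteP/ppcard_leP[e] := Binf.
have e_inj : injective e by move=> k l; apply: inj; rewrite inE.
have branchB X i : branch e X i -> B i by move=> [k _ <-]; exact: funS.
pose v X := indic R n (branch e X).
have Ev X : E (v X) by exact: indic_benyamini.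
have large X : exists i, B i /\ 3 / 4 <= q i (phi (v X)).
  (* [mu i (phi (v X)) = 1] on the branch; since [q_near] is about the unit ball,
     it is applied to a multiple of [phi (v X)]. *)
  pose g := C^-1 *: phi (v X).
  have g1 : `|g| <= 1.
    rewrite normrZ gtr0_norm ?invr_gt0// ler_pdivrMl// mulr1.
    rewrite (le_trans (phi_bound (Ev X)))// -[leRHS]mulr1 ler_pM2l//.
    exact: indic_norm_le1.
  have /infinite_setN0[i [Xi near]] := infinite_setD (@branch_infinite e e_inj X) (q_near g g1).
  have Bi := branchB X i Xi; exists i; split=> //.
  have {near} : ~ (eta < mu i g - q i g) by move=> lt; apply: near.
  move=> /negP; rewrite -leNgt /g (functionalZ (mu_lin i)) (functionalZ (q_lin i)).
  rewrite /mu phiK// /v indic_principal asboolT// mulr1 /weight mulfV ?pnatr_eq0//.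
  rewrite -mulrBr ler_pdivrMl// /eta.
  rewrite (_ : C * (4 * C)^-1 = 1 / 4); last by field; rewrite gt_eqF.
  lra.
have few i : B i -> finite_set [set X | 3 / 4 <= q i (phi (v X))].
  move=> Bi; apply: contrapT => inf.
  have [K' K'large Ksize] := infinite_set_fset (Num.trunc (2 * D)).+1 inf.
  pose K : seq (set nat) := finmap.enum_fset K'; pose m := size K.
  have Kuniq : uniq K by exact: finmap.fset_uniq.
  have Klarge X : X \in K -> 3 / 4 <= q i (phi (v X)) by exact: K'large.
  have [r [Er rle vE]] := sum_indic R n Kuniq (@branch_almost_disjoint e e_inj).
  have [_ phisum] := benyamini_sum K Ev.
  (* Evaluate [q i] on the sum of the [m] detected indicators: it is at least
     [3 m / 4], and at most [D + m / 4]. *)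
  have ge : 3 / 4 * m%:R <= q i (phi (\sum_(X <- K) v X)).
    rewrite phisum (functional_sum (q_lin i)).
    rewrite (_ : 3 / 4 * m%:R = \sum_(X <- K) (3 / 4 : R)); last first.
      by rewrite big_const_seq count_predT iter_addr_0 mulr_natr.
    by rewrite !big_seq; apply: ler_sum => X XK; exact: Klarge.
  have le : q i (phi (\sum_(X <- K) v X)) <= D + 1 / 4 * m%:R.
    rewrite /v vE -[indic _ _ _]scale1r phi_lin ?scale1r//; last exact: indic_benyamini.
    rewrite (functionalD (q_lin i)) lerD//.
      rewrite (le_trans (Q_bound i _ Bi (indic_benyamini _ _ _)))//.
      by rewrite -[leRHS]mulr1 ler_pM2l ?indic_norm_le1.
    rewrite (le_trans (Q_bound i _ Bi Er))//.
    apply: (@le_trans _ _ (D * (m%:R * weight R n))); first by rewrite ler_pM2l.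
    by rewrite mulrCA mulrC ler_wpM2r.
  have : 2 * D < m%:R.
    apply: lt_le_trans (truncnS_gt _) _; by rewrite ler_nat.
  lra.
have : countable [set: set nat].
  apply: (@sub_countable _ _ _ (\bigcup_(i in B) [set X | 3 / 4 <= q i (phi (v X))])).
    by apply: subset_card_le => X _; have [i [Bi ?]] := large X; exists i.
  by apply: bigcup_countable => [|i Bi]; [exact: countableP|exact/finite_set_countable/few].
move=> /countable_injP[f f_inj].
by apply: (@no_injection_sets f) => X Y; apply: f_inj; rewrite inE.
Qed.

End NotIsomorphic.

Theorem corollary5p3 (R : realType)
    (p_eq_c : is_pseudointersection_number [set: R]) :
  exists (S : compactHausdorffType) (E : set (cspace S R)),
    [/\ is_G_space E,
        ~ separable E &
        forall X : completeNormedModType R,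
          is_C_space X -> ~ isomorphic E [set: X]].
Proof.
exists benyamini_compact, (@benyamini R).
split; [exact: benyamini_G_space|exact: benyamini_not_separable|].
move=> X [T XT] EX.
have [phi1 [psi1 [C1 [C10 phi1_lin phi1P psi1_lin psi1P]]]] :=
  isomorphic_bounds (benyamini_submod R) EX.
have Xsub : submod_closed [in [set: X]] by split=> [|a u v _ _]; rewrite inE.
have [phi2 [psi2 [C2 [C20 phi2_lin phi2P psi2_lin psi2P]]]] := isomorphic_bounds Xsub XT.
apply: (@no_isomorphism_to_C R T (phi2 \o phi1) (psi1 \o psi2) (C1 * C2)).
- exact: mulr_gt0.
- by move=> a u v Eu Ev /=; rewrite phi1_lin// phi2_lin.
- by move=> f Ef /=; rewrite (phi2P _ _).1// (phi1P _ Ef).1.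
- move=> f Ef /=; rewrite (le_trans (phi2P _ _).2)// -mulrA mulrCA ler_pM2l//.
  exact: (phi1P _ Ef).2.
- by move=> a u v /=; rewrite psi2_lin psi1_lin.
- by move=> g; exact: (psi1P _).1.
- move=> g /=; rewrite (le_trans (psi1P _).2)// -mulrA ler_pM2l//.
  exact: (psi2P _).2.
Qed.
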